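(* Let $K\in\mathbb{R}^{n\times n}$ be symmetric positive semidefinite, let $\mu>0$, $\delta\in(0,1)$, $\varepsilon\in(0,1)$, and let $\lambda>0$, $\sigma_k>0$. Let $\ell=\mathrm{rank}_\mu(K)$ and let $r$ be an integer with $r\le n$ and \[ r \geq \min\left\{n,\ \ell\left(1+\log\frac{\mathrm{tr}(K)}{\mathrm{tr}(K-\lfloor K\rfloor_{\ell})}\right)\right\}. \] Let $F=\mathrm{RPCholesky}(K,r)$ and $\widehat K=FF^{\top}$. Let $L\in\mathbb{R}^{n\times n}$ be symmetric with $L\succeq \mu I_n$, and set \[ P=\widehat K+\lambda\sigma_k\mathbf{1}_n\mathbf{1}_n^{\top}+L,\qquad A=K+\lambda\sigma_k\mathbf{1}_n\mathbf{1}_n^{\top}+L. \] Then, with probability at least $1-\delta$ (over the randomness of RPCholesky), $\kappa(P^{-1/2}AP^{-1/2})\le 3/\delta$, and furthermore, when the preconditioned conjugate gradient (PCG) method with preconditioner $P$ is applied to the linear system $Ad=b$ (for any $b\in\mathbb{R}^n$), its iterates $d^{\,t}$ satisfy \[ \|d^{\,t}-d^*\|_A\le \varepsilon\|d^*\|_A\quad\text{for every iteration } t\ge \delta^{-1/2}\log(2/\varepsilon), \] where $d^*=A^{-1}b$ is the exact solution.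
   Context: $\mathbf{1}_n$ is the all-ones vector in $\mathbb{R}^n$, $I_n$ the identity, $\succeq$ the Loewner order, $\mathrm{tr}$ the trace, $\kappa(\cdot)$ the condition number of a positive definite matrix, and $\|x\|_A=\sqrt{x^{\top}Ax}$. $\lambda_i(\cdot)$ is the $i$-th largest eigenvalue of a symmetric matrix. $\lfloor K\rfloor_\ell$ denotes the best rank-$\ell$ approximation of $K$ (from its $\ell$-truncated eigendecomposition). The $\mu$-tail rank is $\mathrm{rank}_\mu(K)=\min\{t\in\mathbb{N}:\sum_{i=t+1}^n\lambda_i(K)\le\mu\}$. $\mathrm{RPCholesky}(K,r)$ (randomly pivoted Cholesky) is the randomized algorithm: set $R^{(0)}=K$ and $F$ empty; for $i=1,\dots,r$, sample a pivot index $s_i\in[n]$ with probability $R^{(i-1)}_{jj}/\mathrm{tr}(R^{(i-1)})$ for index $j$, set $g=R^{(i-1)}_{:,s_i}/\sqrt{R^{(i-1)}_{s_is_i}}$, append $g$ as a new column of $F$, and set $R^{(i)}=R^{(i-1)}-gg^{\top}$; output $F\in\mathbb{R}^{n\times r}$. PCG is the standard preconditioned conjugate gradient method, started from the zero vector $d^0=0$. *)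

(* Defs.v *)
From HB Require Import structures.
From mathcomp Require Import all_boot all_order all_algebra.
From mathcomp Require Import all_classical all_reals all_analysis.
Set Implicit Arguments. Unset Strict Implicit. Unset Printing Implicit Defensive.
Import Order.TTheory GRing.Theory Num.Theory.
Local Open Scope ring_scope.
Local Open Scope classical_set_scope.

Section Defs.
Variables (R : realType) (n : nat).
Implicit Types (M : 'M[R]_n) (x : 'cV[R]_n).

Definition qform M x : R := (x^T *m M *m x) 0 0.

Definition psd M : Prop := M^T = M /\ forall x, 0 <= qform M x.

Definition loewner_ge (A B : 'M[R]_n) : Prop := psd (A - B).

Definition Anorm M x : R := Num.sqrt (qform M x).

Definition ones : 'cV[R]_n := const_mx 1.

Definition spec_decomp M (Us : 'M[R]_n * seq R) : Prop :=
  [/\ Us.1^T *m Us.1 = 1%:M, size Us.2 = n, sorted >=%R Us.2 &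
      M = Us.1 *m diag_mx (\row_i Us.2`_i) *m Us.1^T].

(* a chosen ordered spectral decomposition (exists for symmetric M) *)
Definition eigdec M : 'M[R]_n * seq R := xget (0, [::]) (spec_decomp M).

(* eigenvalues lambda_1 >= ... >= lambda_n, stored 0-indexed *)
Definition eig M : seq R := (eigdec M).2.

(* best rank-l approximation from the l-truncated eigendecomposition *)
Definition trunc_approx M (l : nat) : 'M[R]_n :=
  (eigdec M).1 *m diag_mx (\row_i (if (i < l)%N then (eig M)`_i else 0))
    *m (eigdec M).1^T.

Definition tail_rank M (mu : R) : nat :=
  find (fun t => \sum_(t <= i < n) (eig M)`_i <= mu) (iota 0 n.+1).

Definition kappa M : R := (eig M)`_0 / (eig M)`_(n.-1).

Definition msqrt M : 'M[R]_n := xget 0 [set S | psd S /\ S *m S = M].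

Definition minvsqrt M : 'M[R]_n := invmx (msqrt M).

(* probability of choosing pivot j given residual Res; if the residual has
   zero trace (already exhausted) we use the uniform distribution. *)
Definition pivot_prob M (j : 'I_n) : R :=
  if 0 < \tr M then M j j / \tr M else n%:R^-1.

Definition rp_vec M (j : 'I_n) : 'cV[R]_n := (Num.sqrt (M j j))^-1 *: col j M.

Definition rp_step M (j : 'I_n) : 'M[R]_n := M - rp_vec M j *m (rp_vec M j)^T.

Fixpoint rpc_prob M (ss : seq 'I_n) : R :=
  match ss with
  | [::] => 1
  | j :: ss' => pivot_prob M j * rpc_prob (rp_step M j) ss'
  end.

Fixpoint rpc_cols M (ss : seq 'I_n) : seq 'cV[R]_n :=
  match ss with
  | [::] => [::]
  | j :: ss' => rp_vec M j :: rpc_cols (rp_step M j) ss'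
  end.

Definition rpc_F (r : nat) (K : 'M[R]_n) (s : r.-tuple 'I_n) : 'M[R]_(n, r) :=
  \matrix_(i < n, k < r) (nth 0 (rpc_cols K s) k) i 0.

Definition rpc_Pr (r : nat) (K : 'M[R]_n) (E : r.-tuple 'I_n -> Prop) : R :=
  \sum_(s : r.-tuple 'I_n | `[< E s >]) rpc_prob K s.

Fixpoint pcg_state (A P : 'M[R]_n) (b : 'cV[R]_n) (t : nat)
  : 'cV[R]_n * 'cV[R]_n * 'cV[R]_n * 'cV[R]_n :=
  match t with
  | 0 => (0, b, invmx P *m b, invmx P *m b)
  | t'.+1 =>
    let: (d, res, z, p) := pcg_state A P b t' in
    let alpha := (res^T *m z) 0 0 / (p^T *m A *m p) 0 0 in
    let d' := d + alpha *: p in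
    let res' := res - alpha *: (A *m p) in
    let z' := invmx P *m res' in
    let beta := (res'^T *m z') 0 0 / (res^T *m z) 0 0 in
    (d', res', z', z' + beta *: p)
  end.

Definition pcg_iter (A P : 'M[R]_n) (b : 'cV[R]_n) (t : nat) : 'cV[R]_n :=
  (pcg_state A P b t).1.1.1.

End Defs.

(* Main.v *)
(** Let [u_1, ..., u_n] be an eigenbasis of [K], and split the trace of a
    residual [M] of RPCholesky into the energy [a] carried by the leading [l]
    eigenvectors and the coenergy carried by the others.  Each residual lies
    below the previous one, so the coenergy never exceeds the initial tail [b].
    One random pivot lowers [u^T M u] by [|M u|^2 / tr M] on average, so by
    Cauchy-Schwarz the mean of [a] drops to at most [a - a^2 / (l (a + b))].
    This map is concave and nondecreasing, so Jensen's inequality lets it be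
    iterated along the algorithm, and the potential [ln a - b / a] shows that
    [l (1 + ln (tr K / b))] steps bring [a] below [b].  If instead [r = n],
    every pivot clears a diagonal entry for good and the residual vanishes.
    The final residual thus has mean trace at most [2 mu]; by Markov's
    inequality its trace is at most [2 mu / delta] with probability at least
    [1 - delta], and then [P <= A <= P + (2 / delta) mu I <= (3 / delta) P].

    For PCG, the residual is orthogonal to the Krylov space, so the error is
    at most that of any polynomial method; the Chebyshev polynomial of
    [1, 3 / delta], which contains the spectrum of [P^(-1/2) A P^(-1/2)],
    gives the rate. *)

Require Import Defs.
From HB Require Import structures.
From mathcomp Require Import all_boot all_order all_algebra.
From mathcomp Require Import all_classical all_reals all_analysis.
From mathcomp Require Import ring lra.
Import Order.TTheory GRing.Theory Num.Theory.
Import numFieldTopology.Exports numFieldNormedType.Exports.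
Local Open Scope ring_scope.
Set Implicit Arguments. Unset Strict Implicit. Unset Printing Implicit Defensive.

(** * Inner products and quadratic forms *)

Definition dot {R : realType} {n : nat} (x y : 'cV[R]_n) : R := (x^T *m y) 0 0.

Section DotProduct.
Variables (R : realType).
Implicit Types (n : nat).

Lemma dotE n (x y : 'cV[R]_n) : dot x y = \sum_i x i 0 * y i 0.
Proof. by rewrite /dot mxE; apply: eq_bigr => i _; rewrite mxE. Qed.

Lemma dotC n (x y : 'cV[R]_n) : dot x y = dot y x.
Proof. by rewrite !dotE; apply: eq_bigr => i _; rewrite mulrC. Qed.

Lemma dotDl n (x y z : 'cV[R]_n) : dot (x + y) z = dot x z + dot y z.
Proof. by rewrite /dot raddfD mulmxDl mxE. Qed.

Lemma dotDr n (x y z : 'cV[R]_n) : dot z (x + y) = dot z x + dot z y.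
Proof. by rewrite /dot mulmxDr mxE. Qed.

Lemma dotZl n a (x z : 'cV[R]_n) : dot (a *: x) z = a * dot x z.
Proof. by rewrite /dot linearZ /= -scalemxAl mxE. Qed.

Lemma dotZr n a (x z : 'cV[R]_n) : dot z (a *: x) = a * dot z x.
Proof. by rewrite /dot -scalemxAr mxE. Qed.

Lemma dotNl n (x z : 'cV[R]_n) : dot (- x) z = - dot x z.
Proof. by rewrite -scaleN1r dotZl mulN1r. Qed.

Lemma dotNr n (x z : 'cV[R]_n) : dot z (- x) = - dot z x.
Proof. by rewrite -scaleN1r dotZr mulN1r. Qed.

Lemma dotBl n (x y z : 'cV[R]_n) : dot (x - y) z = dot x z - dot y z.
Proof. by rewrite dotDl dotNl. Qed.

Lemma dotBr n (x y z : 'cV[R]_n) : dot z (x - y) = dot z x - dot z y.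
Proof. by rewrite dotDr dotNr. Qed.

Lemma dot0r n (x : 'cV[R]_n) : dot x 0 = 0.
Proof. by rewrite /dot mulmx0 mxE. Qed.

Lemma dot0l n (x : 'cV[R]_n) : dot 0 x = 0.
Proof. by rewrite dotC dot0r. Qed.

Lemma dot_mulmxl m n (M : 'M[R]_(m, n)) (x : 'cV_n) (y : 'cV_m) :
  dot (M *m x) y = dot x (M^T *m y).
Proof. by rewrite /dot trmx_mul mulmxA. Qed.

Lemma dot_ge0 n (x : 'cV[R]_n) : 0 <= dot x x.
Proof. by rewrite dotE sumr_ge0// => i _; rewrite -expr2 sqr_ge0. Qed.

Lemma dot_eq0 n (x : 'cV[R]_n) : (dot x x == 0) = (x == 0).
Proof.
apply/eqP/eqP => [|->]; last exact: dot0r.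
rewrite dotE => /eqP; rewrite psumr_eq0; last first.
  by move=> i _; rewrite -expr2 sqr_ge0.
move=> /allP h; apply/matrixP => i j; rewrite (ord1 j) mxE.
by have := h i (mem_index_enum _); rewrite /= -expr2 sqrf_eq0 => /eqP.
Qed.

Lemma dot_gt0 n (x : 'cV[R]_n) : (0 < dot x x) = (x != 0).
Proof. by rewrite lt_def dot_ge0 andbT dot_eq0. Qed.

Lemma dot_delta n (x : 'cV[R]_n) j : dot x (delta_mx j 0) = x j 0.
Proof. by rewrite /dot -colE !mxE. Qed.

Lemma qformE n (M : 'M[R]_n) (x : 'cV_n) : qform M x = dot x (M *m x).
Proof. by rewrite /qform /dot mulmxA. Qed.

Lemma qform_delta n (M : 'M[R]_n) j : qform M (delta_mx j 0) = M j j.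
Proof. by rewrite qformE dotC dot_delta -colE mxE. Qed.

Lemma qformD n (M N : 'M[R]_n) (x : 'cV_n) : qform (M + N) x = qform M x + qform N x.
Proof. by rewrite !qformE mulmxDl dotDr. Qed.

Lemma qformB n (M N : 'M[R]_n) (x : 'cV_n) : qform (M - N) x = qform M x - qform N x.
Proof. by rewrite !qformE mulmxBl dotBr. Qed.

Lemma qformZ n a (M : 'M[R]_n) (x : 'cV_n) : qform (a *: M) x = a * qform M x.
Proof. by rewrite !qformE -scalemxAl dotZr. Qed.

Lemma qform_scalar n a (x : 'cV[R]_n) : qform a%:M x = a * dot x x.
Proof. by rewrite qformE mul_scalar_mx dotZr. Qed.

Lemma qform_outer n (g x : 'cV[R]_n) : qform (g *m g^T) x = dot g x ^+ 2.
Proof.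
rewrite qformE -mulmxA [g^T *m x]mx11_scalar -/(dot g x) mul_mx_scalar dotZr.
by rewrite dotC expr2.
Qed.

Lemma qform_conj m n (M : 'M[R]_m) (S : 'M[R]_(m, n)) x :
  qform (S^T *m M *m S) x = qform M (S *m x).
Proof. by rewrite !qformE dot_mulmxl !mulmxA. Qed.

Lemma dot_sym n (M : 'M[R]_n) x y : M^T = M -> dot (M *m x) y = dot x (M *m y).
Proof. by move=> MT; rewrite dot_mulmxl MT. Qed.

(** The form at [x - s *: y] is a nonnegative quadratic in [s]; it is evaluated at its minimiser. *)
Lemma psd_CauchySchwarz n (M : 'M[R]_n) x y : psd M ->
  dot x (M *m y) ^+ 2 <= qform M x * qform M y.
Proof.
move=> [MT Mge].
have hq s : 0 <= qform M x - 2 * s * dot x (M *m y) + s ^+ 2 * qform M y.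
  have := Mge (x - s *: y); rewrite !qformE mulmxBr -scalemxAr.
  rewrite !dotBl !dotBr !dotZl !dotZr (dotC y (M *m x)) (dot_sym _ _ MT).
  by set a := dot _ _; set b := dot _ _; set c := dot _ _; nra.
have [q0|qn0] := eqVneq (qform M y) 0.
  rewrite q0 mulr0; have [->|cn0] := eqVneq (dot x (M *m y)) 0.
    by rewrite expr0n.
  (* Without a quadratic term, this [s] would give the value [-1]. *)
  have := hq ((qform M x + 1) / (2 * dot x (M *m y))); rewrite q0 mulr0 addr0.
  have -> : 2 * ((qform M x + 1) / (2 * dot x (M *m y))) * dot x (M *m y)
     = qform M x + 1 by field; rewrite cn0.
  by lra.
have q0 : 0 < qform M y by rewrite lt_def qn0 Mge.
have := hq (dot x (M *m y) / qform M y).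
have -> : qform M x - 2 * (dot x (M *m y) / qform M y) * dot x (M *m y)
     + (dot x (M *m y) / qform M y) ^+ 2 * qform M y
   = (qform M x * qform M y - dot x (M *m y) ^+ 2) / qform M y by field.
by rewrite pmulr_lge0 ?invr_gt0// subr_ge0.
Qed.

Lemma psd1 n : psd (1%:M : 'M[R]_n).
Proof. by split=> [|x]; rewrite ?trmx1// qform_scalar mul1r dot_ge0. Qed.

Lemma dot_CauchySchwarz n (x y : 'cV[R]_n) : dot x y ^+ 2 <= dot x x * dot y y.
Proof. by have := psd_CauchySchwarz x y (psd1 n); rewrite !qformE !mul1mx. Qed.

Lemma psd_mulmx_eq0 n (M : 'M[R]_n) y : psd M -> qform M y = 0 -> M *m y = 0.
Proof.
move=> Mp y0; apply/eqP; rewrite -dot_eq0 -sqrf_eq0 eq_le sqr_ge0 andbT.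
by have := psd_CauchySchwarz (M *m y) y Mp; rewrite y0 mulr0.
Qed.

Lemma psdD n (M N : 'M[R]_n) : psd M -> psd N -> psd (M + N).
Proof.
move=> [MT Mp] [NT Np]; split; first by rewrite linearD /= MT NT.
by move=> x; rewrite qformD addr_ge0.
Qed.

Lemma psdZ n a (M : 'M[R]_n) : 0 <= a -> psd M -> psd (a *: M).
Proof.
move=> a0 [MT Mp]; split; first by rewrite linearZ /= MT.
by move=> x; rewrite qformZ mulr_ge0.
Qed.

Lemma psd_outer m n (F : 'M[R]_(m, n)) : psd (F *m F^T).
Proof.
split=> [|x]; first by rewrite trmx_mul trmxK.
by rewrite qformE -mulmxA -[F in F *m _]trmxK -dot_mulmxl dot_ge0.
Qed.

Lemma psd_diag_ge0 n (M : 'M[R]_n) j : psd M -> 0 <= M j j.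
Proof. by move=> [_ Mp]; rewrite -qform_delta. Qed.

Lemma psd_tr_ge0 n (M : 'M[R]_n) : psd M -> 0 <= \tr M.
Proof. by move=> Mp; apply: sumr_ge0 => j _; exact: psd_diag_ge0. Qed.

End DotProduct.


(** * Spectral theorem for real symmetric matrices *)

Section Spectral.
Local Open Scope classical_set_scope.
Variables (R : realType) (n : nat).
Implicit Types (M : 'M[R]_n) (u : nat -> 'cV[R]_n) (d : nat -> R).

Lemma continuous_sum_mul (f g : 'I_n -> 'rV[R]_n -> R) :
  (forall i, continuous (f i)) -> (forall i, continuous (g i)) ->
  continuous (fun x => \sum_i f i x * g i x).
Proof.
move=> cf cg.
have := @continuous_big R 'I_n +%R 0 xpredT (@add_continuous R) 'rV[R]_n
  (index_enum 'I_n) (fun i x => f i x * g i x).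
by apply=> i _ x; apply: continuousM; [exact: cf | exact: cg].
Qed.

Lemma continuous_dot_tr (y : 'cV[R]_n) : continuous (fun x : 'rV[R]_n => dot x^T y).
Proof.
rewrite (_ : (fun x => _) = fun x : 'rV[R]_n => \sum_i x 0 i * y i 0); last first.
  by apply/funext => x; rewrite dotE; apply: eq_bigr => i _; rewrite mxE.
apply: (@continuous_sum_mul (fun i x => x 0 i) (fun i x => y i 0)) => i x.
  exact: (@coord_continuous R 1 n 0 i x).
exact: cst_continuous.
Qed.

Lemma continuous_qform_tr M : continuous (fun x : 'rV[R]_n => qform M x^T).
Proof.
rewrite (_ : (fun x => _) =
    fun x : 'rV[R]_n => \sum_i x 0 i * dot x^T (row i M)^T); last first.
  apply/funext => x; rewrite qformE dotE; apply: eq_bigr => i _; rewrite mxE.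
  congr (_ * _); rewrite dotE mxE; apply: eq_bigr => j _.
  by rewrite !mxE mulrC.
apply: (@continuous_sum_mul (fun i x => x 0 i)) => i x.
  exact: coord_continuous.
exact: continuous_dot_tr.
Qed.

(** The [n] by [k] matrix with columns [u j] has rank below [n], hence a nonzero left kernel. *)
Lemma exists_orthogonal_unit (u : nat -> 'cV[R]_n) k : (k < n)%N ->
  exists w : 'cV[R]_n, dot w w = 1 /\ forall j, (j < k)%N -> dot w (u j) = 0.
Proof.
move=> kn.
pose V : 'M[R]_(n, k) := \matrix_(i < n, j < k) u j i 0.
have : kermx V != 0.
  rewrite -mxrank_eq0 mxrank_ker subn_eq0 -ltnNge.
  by rewrite (leq_ltn_trans (rank_leq_col V)).
case/rowV0Pn => v /sub_kermxP vV v0.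
have v0' : v^T != 0 by rewrite -(inj_eq trmx_inj) trmxK trmx0.
have vp : 0 < dot v^T v^T by rewrite dot_gt0.
exists ((Num.sqrt (dot v^T v^T))^-1 *: v^T); split.
  rewrite dotZl dotZr mulrA -invfM -expr2 sqr_sqrtr ?ltW// mulVf//.
  by rewrite gt_eqF.
move=> j jk; rewrite dotZl.
suff -> : dot v^T (u j) = 0 by rewrite mulr0.
have := congr1 (fun X : 'rV[R]_k => X 0 (Ordinal jk)) vV.
rewrite !mxE => <-; rewrite dotE; apply: eq_bigr => i _.
by rewrite !mxE.
Qed.

Lemma closed_level (f : 'rV[R]_n -> R) (c : R) :
  continuous f -> closed [set x | f x = c].
Proof.
move=> cf; have := @preimage_closed _ _ f [set y | y = c].
by apply=> [x _|]; [exact: cf | exact: closed_eq].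
Qed.

(** The maximum over the compact unit sphere of the orthogonal complement extends to the whole
    complement by homogeneity. *)
Lemma max_qform M u k : (k < n)%N ->
  exists w : 'cV[R]_n, [/\ dot w w = 1, forall j, (j < k)%N -> dot w (u j) = 0 &
    forall x, (forall j, (j < k)%N -> dot x (u j) = 0) ->
      qform M x <= qform M w * dot x x].
Proof.
move=> kn.
pose A : set 'rV[R]_n :=
  [set x | dot x^T x^T = 1 /\ forall j, (j < k)%N -> dot x^T (u j) = 0].
have Aclosed : closed A.
  have -> : A = [set x : 'rV_n | qform 1%:M x^T = 1] `&`
      \bigcap_(j in `I_k) [set x : 'rV_n | dot x^T (u j) = 0].
    apply/seteqP; split=> x /=; rewrite qform_scalar mul1r.
      by move=> [? ?]; split.
    by move=> [? ?]; split.
  apply: closedI; first exact/closed_level/continuous_qform_tr.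
  by apply: closed_bigI => j _; exact/closed_level/continuous_dot_tr.
have Abounded : bounded_set A.
  exists 1; split => // e e1 x [x1 _].
  rewrite /= [X in X <= _]/Num.norm /= mx_normrE; apply/bigmax_leP; split=> [|[i j] _ /=].
    by rewrite ltW// (lt_trans _ e1).
  rewrite (le_trans _ (ltW e1))// -(@expr_le1 _ 2)//.
  rewrite real_normK ?num_real// -x1 dotE (bigD1 j)//= !mxE -expr2 (ord1 i).
  by rewrite lerDl sumr_ge0// => l _; rewrite -expr2 sqr_ge0.
have [w0 [w01 w0u]] := exists_orthogonal_unit u kn.
have A0 : A !=set0 by exists w0^T; split; rewrite trmxK.
have [c] := EVT_max_rV A0 (bounded_closed_compact Abounded Aclosed)
  (continuous_subspaceT (@continuous_qform_tr M)).
rewrite inE => -[c1 cu] cmax.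
exists c^T; split => // x xu.
have [->|x0] := eqVneq x 0.
  by rewrite qformE !dot0l mulr0.
have xp : 0 < dot x x by rewrite dot_gt0.
have sp : 0 < Num.sqrt (dot x x) by rewrite sqrtr_gt0.
set s := Num.sqrt _ in sp.
have ss : s ^+ 2 = dot x x by rewrite sqr_sqrtr// ltW.
have : qform M ((s^-1 *: x)^T)^T <= qform M c^T.
  apply: cmax; rewrite inE; split; rewrite trmxK.
    by rewrite dotZl dotZr mulrA -invfM -expr2 ss mulVf// gt_eqF.
  by move=> j jk; rewrite dotZl xu// mulr0.
rewrite trmxK qformE -scalemxAr dotZl dotZr -qformE mulrA -invfM -expr2 ss.
by rewrite mulrC ler_pdivrMr.
Qed.

(* A maximiser [w] of the Rayleigh quotient over an invariant subspace [W] is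
   an eigenvector: [qform M w - M] is positive semidefinite on [W] and vanishes
   at [w], so by Cauchy-Schwarz [(qform M w - M) w] is orthogonal to [W]. *)
Lemma max_qform_eigen M u d k w : M^T = M ->
  (forall j, (j < k)%N -> M *m u j = d j *: u j) ->
  dot w w = 1 -> (forall j, (j < k)%N -> dot w (u j) = 0) ->
  (forall x, (forall j, (j < k)%N -> dot x (u j) = 0) ->
      qform M x <= qform M w * dot x x) ->
  M *m w = qform M w *: w.
Proof.
move=> MT Mu w1 wu wmax.
set a := qform M w in wmax *.
pose y := a *: w - M *m w.
have yu j : (j < k)%N -> dot y (u j) = 0.
  move=> jk; rewrite dotBl dotZl wu// mulr0 dot_sym// Mu// dotZr wu//.
  by rewrite mulr0 subr0.
have wMw : dot w (M *m w) = a by rewrite -qformE.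
have wy : dot w y = 0 by rewrite dotBr dotZr w1 mulr1 wMw subrr.
have Mw : M *m w = a *: w - y by rewrite /y opprB addrC subrK.
clearbody y; suff : dot y y == 0 by rewrite dot_eq0 Mw => /eqP ->; rewrite subr0.
have h s : 2 * s * dot y y <= s ^+ 2 * (a * dot y y - qform M y).
  have yMw : dot y (M *m w) = - dot y y.
    by rewrite Mw dotBr dotZr (dotC y w) wy mulr0 sub0r.
  have wMy : dot w (M *m y) = - dot y y by rewrite -dot_sym// dotC.
  have := wmax (w - s *: y); rewrite !qformE mulmxBr -scalemxAr.
  rewrite !dotBl !dotBr !dotZl !dotZr wMw w1 (dotC y w) wy yMw wMy.
  have hu : forall j, (j < k)%N -> dot (w - s *: y) (u j) = 0.
    by move=> j jk; rewrite dotBl dotZl wu// yu// mulr0 subr0.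
  by move=> /(_ hu); lra.
apply: contraT => yn0.
have yp : 0 < dot y y by rewrite lt_def dot_ge0 andbT.
set N := dot y y in h yp *; set C := a * N - _ in h.
have C1 : 0 < `|C| + 1 by rewrite ltr_wpDl.
(* At this [s] the inequality [h] reduces to [2 (|C| + 1) <= C], which is absurd. *)
have := h (N / (`|C| + 1)).
have -> : 2 * (N / (`|C| + 1)) * N = (N / (`|C| + 1)) ^+ 2 * (2 * (`|C| + 1)).
  by field; rewrite gt_eqF.
rewrite ler_pM2l ?exprn_gt0 ?divr_gt0//.
by have := ler_norm C; have := normr_ge0 C; lra.
Qed.

(** Deflation: each step adds a maximiser of the Rayleigh quotient on the complement of the previous
    vectors. The third clause is what later sorts the eigenvalues. *)
Lemma ordered_eigenbasis M k : M^T = M -> (k <= n)%N ->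
  exists u d, [/\ forall j, (j < k)%N -> M *m u j = d j *: u j,
    forall i j, (i < k)%N -> (j < k)%N -> dot (u i) (u j) = (i == j)%:R &
    forall j x, (j < k)%N -> (forall i, (i < j)%N -> dot x (u i) = 0) ->
      qform M x <= d j * dot x x].
Proof.
move=> MT; elim: k => [|k IH] kn.
  by exists (fun=> 0), (fun=> 0).
have [u [d [Mu uu umax]]] := IH (ltnW kn).
have [w [w1 wu wmax]] := max_qform M u kn.
have Mw := max_qform_eigen MT Mu w1 wu wmax.
exists (fun j => if j == k then w else u j),
  (fun j => if j == k then qform M w else d j); split.
- move=> j; rewrite ltnS; case: eqVneq => [//|jk jk'].
  by rewrite Mu// ltn_neqAle jk.
- move=> i j; rewrite !ltnS => ik jk.
  have [eik|nik] := boolP (i == k); have [ejk|njk] := boolP (j == k).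
  + by rewrite w1 (eqP eik) (eqP ejk) eqxx.
  + by rewrite wu ?ltn_neqAle ?njk// (eqP eik) eq_sym (negbTE njk).
  + by rewrite dotC wu ?ltn_neqAle ?nik// (eqP ejk) (negbTE nik).
  + by rewrite uu// ltn_neqAle ?nik ?njk.
- move=> j x; rewrite ltnS; case: eqVneq => [->|jk] jk' xu.
    apply: wmax => i ik; have := xu i ik; by rewrite ltn_eqF.
  have jk2 : (j < k)%N by rewrite ltn_neqAle jk.
  apply: umax => // i ij; have := xu i ij.
  by rewrite ltn_eqF// (ltn_trans ij).
Qed.

Lemma exists_spec_decomp M : M^T = M -> exists Us, spec_decomp M Us.
Proof.
move=> MT.
have [u [d [Mu uu umax]]] := ordered_eigenbasis MT (leqnn n).
pose U : 'M[R]_n := \matrix_(i < n, j < n) u j i 0.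
have colU j : col j U = u j by apply/matrixP => i l; rewrite (ord1 l) !mxE.
have UU : U^T *m U = 1%:M.
  apply/matrixP => i j; rewrite !mxE -val_eqE /= -(uu i j)// dotE.
  apply: eq_bigr => l _.
  by rewrite !mxE.
have MU : M *m U = U *m diag_mx (\row_i (mkseq d n)`_i).
  apply/matrixP => i j.
  have -> : (M *m U) i j = (M *m col j U) i 0.
    by rewrite !mxE; apply: eq_bigr => l _; rewrite !mxE.
  rewrite colU Mu// mul_mx_diag !mxE nth_mkseq//.
  by rewrite mulrC.
exists (U, mkseq d n); split => //=.
- by rewrite size_mkseq.
- apply/(sortedP 0) => i; rewrite size_mkseq => i1.
  rewrite !nth_mkseq// ?(ltnW i1)//.
  have := umax i (u i.+1) (ltnW i1); rewrite qformE Mu// dotZr uu// eqxx !mulr1.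
  apply=> j ji; have ji1 : (j < i.+1)%N by rewrite ltnW.
  by rewrite uu ?gtn_eqF// (ltn_trans ji1).
- by rewrite -MU -mulmxA (mulmx1C UU) mulmx1.
Qed.

End Spectral.

(** * Randomly pivoted Cholesky *)

Section RandomlyPivotedCholesky.
Variables (R : realType) (n : nat).
Implicit Types (M : 'M[R]_n) (x : 'cV[R]_n) (s : seq 'I_n).

(** Since [0^-1 = 0], a pivot on a zero diagonal entry leaves the residual unchanged. *)
Lemma rp_vec_diag0 M j : M j j = 0 -> rp_vec M j = 0.
Proof. by move=> Mj0; rewrite /rp_vec Mj0 sqrtr0 invr0 scale0r. Qed.

(** The factor [M j j] lets the identity cover a zero pivot too, where [M e_j = 0] by
    Cauchy-Schwarz. *)
Lemma dot_rp_vec M j x : psd M ->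
  M j j * dot (rp_vec M j) x ^+ 2 = (M *m x) j 0 ^+ 2.
Proof.
move=> Mp; have [MT _] := Mp.
have [Mj0|Mj] := eqVneq (M j j) 0.
  have /(psd_mulmx_eq0 Mp) e0 : qform M (delta_mx j 0) = 0 by rewrite qform_delta.
  by rewrite Mj0 mul0r -dot_delta dotC -dot_sym// e0 dot0l expr0n.
rewrite /rp_vec dotZl exprMn exprVn sqr_sqrtr ?psd_diag_ge0// mulrA divff// mul1r.
by rewrite colE dot_sym// dotC dot_delta.
Qed.

Lemma qform_rp_step M j x :
  qform (rp_step M j) x = qform M x - dot (rp_vec M j) x ^+ 2.
Proof. by rewrite /rp_step qformB qform_outer. Qed.

(** For a positive pivot this is Cauchy-Schwarz for the form [M] between [e_j] and [x]. *)
Lemma psd_rp_step M j : psd M -> psd (rp_step M j).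
Proof.
move=> Mp; have [MT Mge] := Mp; split=> [|x].
  by rewrite /rp_step linearB /= MT trmx_mul trmxK.
rewrite qform_rp_step; have [Mj0|Mj] := eqVneq (M j j) 0.
  by rewrite rp_vec_diag0// dot0l expr0n subr0.
have Mjp : 0 < M j j by rewrite lt_def Mj psd_diag_ge0.
rewrite subr_ge0 -(ler_pM2l Mjp) dot_rp_vec// -dot_delta dotC -qform_delta.
exact: psd_CauchySchwarz.
Qed.

Lemma rp_step_le M j x : qform (rp_step M j) x <= qform M x.
Proof. by rewrite qform_rp_step gerBl sqr_ge0. Qed.

Lemma psd_tr0 M j : psd M -> \tr M = 0 -> M j j = 0.
Proof.
move=> Mp /eqP; rewrite psumr_eq0 => [/allP h|i _]; last exact: psd_diag_ge0.
by have /eqP := h j (mem_index_enum _).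
Qed.

Lemma pivot_prob_ge0 M j : psd M -> 0 <= pivot_prob M j.
Proof.
move=> Mp; rewrite /pivot_prob; case: ifP => [h|_]; last by rewrite invr_ge0.
by rewrite divr_ge0 ?psd_diag_ge0// ltW.
Qed.

Lemma sum_pivot_prob M : (0 < n)%N -> \sum_j pivot_prob M j = 1.
Proof.
move=> n0; rewrite /pivot_prob; have [h|_] := ltP 0 (\tr M).
  by rewrite -mulr_suml divff// gt_eqF.
by rewrite sumr_const card_ord -[LHS]mulr_natr mulVf// pnatr_eq0 -lt0n.
Qed.

Lemma rpc_prob_ge0 M s : psd M -> 0 <= rpc_prob M s.
Proof.
elim: s M => [|j s IH] M Mp //=.
by rewrite mulr_ge0 ?pivot_prob_ge0// IH//; exact: psd_rp_step.
Qed.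

Lemma psd_foldl_rp_step M s : psd M -> psd (foldl (@rp_step R n) M s).
Proof. by elim: s M => //= j s IH M Mp; exact/IH/psd_rp_step. Qed.

Lemma foldl_rp_step M s :
  foldl (@rp_step R n) M s = M - \sum_(c <- rpc_cols M s) c *m c^T.
Proof.
elim: s M => [|j s IH] M /=; first by rewrite big_nil subr0.
by rewrite IH big_cons /rp_step opprD addrA.
Qed.

Lemma size_rpc_cols M s : size (rpc_cols M s) = size s.
Proof. by elim: s M => //= j s IH M; rewrite IH. Qed.

Lemma rpc_residual (r : nat) M (s : r.-tuple 'I_n) :
  foldl (@rp_step R n) M s = M - rpc_F M s *m (rpc_F M s)^T.
Proof.
rewrite foldl_rp_step; congr (_ - _).
rewrite (big_nth 0) big_mkord size_rpc_cols size_tuple.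
apply/matrixP => i j; rewrite summxE !mxE; apply: eq_bigr => k _.
by rewrite !mxE big_ord1 !mxE.
Qed.

(** Mean of [h] at the residual after [r] random pivots, conditioned on the first pivot so that
    induction on [r] applies. *)
Fixpoint rpc_E (h : 'M[R]_n -> R) (r : nat) M : R :=
  if r is r'.+1 then \sum_j pivot_prob M j * rpc_E h r' (rp_step M j) else h M.

Lemma rpc_E_sum h r M :
  rpc_E h r M =
  \sum_(s : r.-tuple 'I_n) rpc_prob M s * h (foldl (@rp_step R n) M s).
Proof.
elim: r M => [|r IH] M /=.
  rewrite (big_pred1 [tuple]) /= ?mul1r// => s; exact/esym/eqP/tuple0.
rewrite (reindex (fun p : 'I_n * r.-tuple 'I_n => [tuple of p.1 :: p.2])) /=.
  rewrite -(pair_bigA _ (fun j (s : r.-tuple 'I_n) =>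
    pivot_prob M j * rpc_prob (rp_step M j) s *
    h (foldl (@rp_step R n) (rp_step M j) s))) /=.
  apply: eq_bigr => j _; rewrite IH mulr_sumr; apply: eq_bigr => s _.
  by rewrite mulrA.
exists (fun s : r.+1.-tuple 'I_n => (thead s, [tuple of behead s])) => s _.
  by case: s => j s; congr (_, _); apply/val_inj.
by rewrite -tuple_eta.
Qed.

(** The bound [r <= n] ensures that an index exists whenever a pivot is drawn. *)
Lemma rpc_E1 r M : (r <= n)%N -> rpc_E (fun=> 1) r M = 1.
Proof.
elim: r M => //= r IH M rn; have n0 : (0 < n)%N by case: n rn.
rewrite -[RHS](sum_pivot_prob M n0); apply: eq_bigr => j _.
by rewrite IH ?mulr1// ltnW.
Qed.

(** Termwise comparison: [1 - tr / c] is at most 1 everywhere, and at most 0 outside [E], where the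
    trace exceeds [c]. *)
Lemma rpc_Markov r M (E : r.-tuple 'I_n -> Prop) (c : R) :
  (r <= n)%N -> psd M -> 0 < c ->
  (forall s : r.-tuple 'I_n, \tr (foldl (@rp_step R n) M s) <= c -> E s) ->
  1 - rpc_E (@mxtrace R n) r M / c <= rpc_Pr M E.
Proof.
move=> rn Mp c0 hE; rewrite -(rpc_E1 M rn) !rpc_E_sum mulr_suml -sumrB.
rewrite /rpc_Pr [leRHS]big_mkcond /=; apply: ler_sum => s _.
rewrite mulr1 -mulrA -{1}[rpc_prob M s]mulr1 -mulrBr.
have p0 := rpc_prob_ge0 s Mp.
have t0 := psd_tr_ge0 (psd_foldl_rp_step s Mp).
have [Es|nEs] := asboolP (E s).
  by rewrite ler_piMr// gerBl divr_ge0// ltW.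
rewrite mulr_ge0_le0// subr_le0 ler_pdivlMr// mul1r leNgt.
by apply/negP => /ltW /hE.
Qed.

(** Zero diagonal entries stay zero, and a pivot of positive probability clears its own entry, so
    the count of nonzero entries drops until it reaches 0. *)
Lemma rpc_E_exhaust r M : psd M -> (#|[set j | M j j != 0%R]| <= r)%N ->
  rpc_E (@mxtrace R n) r M = 0.
Proof.
elim: r M => [|r IH] M Mp /=.
  rewrite leqn0 cards_eq0 => /eqP M0; rewrite /mxtrace big1// => j _.
  apply/eqP; apply: contraT => Mj.
  by have := finset.in_set0 j; rewrite -M0 inE Mj.
move=> Mr; rewrite big1// => j _.
have [->|pj] := eqVneq (pivot_prob M j) 0; first by rewrite mul0r.
rewrite IH ?mulr0//; first exact: psd_rp_step.
have sub k : (rp_step M j) k k != 0 -> M k k != 0.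
  apply: contra_neq => Mk0; apply/eqP; rewrite eq_le psd_diag_ge0 ?andbT.
    by rewrite -!qform_delta (le_trans (rp_step_le _ _ _))// qform_delta Mk0.
  exact: psd_rp_step.
(* At zero trace the uniform rule may draw any index, but the whole diagonal is zero already. *)
have [M0|Mn0] := eqVneq (\tr M) 0.
  rewrite (_ : finset _ = finset.set0) ?cards0//; apply/finset.setP => k; rewrite !inE.
  by apply/negbTE/negP => h; have := sub k h; rewrite psd_tr0// eqxx.
have trM : 0 < \tr M by rewrite lt_def Mn0 psd_tr_ge0.
have Mj : M j j != 0.
  by apply: contra_neq pj; rewrite /pivot_prob trM => ->; rewrite mul0r.
rewrite -ltnS (leq_trans _ Mr)// proper_card//; apply/properP; split.
  by apply/fintype.subsetP => k; rewrite !inE; exact: sub.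
exists j; rewrite !inE// negbK.
rewrite -qform_delta qform_rp_step qform_delta -[X in X - _](mulfK Mj).
have := dot_rp_vec j (delta_mx j 0) Mp.
rewrite -colE [X in _ = X ^+ 2]mxE => h.
by rewrite -expr2 -h mulrAC divff// mul1r subrr.
Qed.

(** The weight [M j j / tr M] cancels the normalisation of [rp_vec], leaving [(M x)_j ^ 2 / tr M].
    At zero trace both corrections vanish. *)
Lemma rpc_mean_qform M x : (0 < n)%N -> psd M ->
  \sum_j pivot_prob M j * qform (rp_step M j) x =
  qform M x - dot (M *m x) (M *m x) / \tr M.
Proof.
move=> n0 Mp.
under eq_bigr do rewrite qform_rp_step mulrBr.
rewrite sumrB -mulr_suml sum_pivot_prob// mul1r; congr (_ - _).
have [M0|Mn0] := eqVneq (\tr M) 0.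
  rewrite M0 invr0 mulr0 big1// => j _.
  by rewrite rp_vec_diag0 ?psd_tr0// dot0l expr0n mulr0.
have trM : 0 < \tr M by rewrite lt_def Mn0 psd_tr_ge0.
rewrite dotE mulr_suml; apply: eq_bigr => j _.
by rewrite /pivot_prob trM mulrAC dot_rp_vec// expr2.
Qed.

End RandomlyPivotedCholesky.

(** * The scalar recursion for the leading energy *)

Section EnergyRecursion.
Variables (R : realType) (c b : R).
Hypotheses (c1 : 1 <= c) (b0 : 0 < b).

(** Bound on the mean energy after one pivot, where [c] bounds the number of leading eigenvectors
    and [b] the coenergy. *)
Definition energy_map (x : R) : R := x - x ^+ 2 / (c * (x + b)).

Let c0 : 0 < c. Proof. exact: lt_le_trans ltr01 c1. Qed.

(** The right side at [c = 1] is the left side; this keeps iterates nonnegative, and positive when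
    the start is. *)
Lemma energy_map_ge x : 0 <= x -> x * b / (x + b) <= energy_map x.
Proof.
move=> x0; have xb : 0 < x + b by rewrite ltr_wpDl.
rewrite /energy_map -subr_ge0.
have -> : x - x ^+ 2 / (c * (x + b)) - x * b / (x + b) =
    x ^+ 2 * (c - 1) / (c * (x + b)).
  by field; rewrite !gt_eqF.
by rewrite divr_ge0 ?mulr_ge0 ?sqr_ge0 ?subr_ge0// ltW.
Qed.

Lemma energy_map_ge0 x : 0 <= x -> 0 <= energy_map x.
Proof.
move=> x0; apply: le_trans (energy_map_ge x0).
by rewrite divr_ge0 ?mulr_ge0 ?addr_ge0// ltW.
Qed.

Lemma energy_map_gt0 x : 0 < x -> 0 < energy_map x.
Proof.
move=> x0; apply: lt_le_trans (energy_map_ge (ltW x0)).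
by rewrite divr_gt0 ?mulr_gt0 ?addr_gt0.
Qed.

(** Concavity in the form of a tangent line: the slope is the derivative at [m], and the gap to the
    tangent is a square over a positive number. *)
Lemma energy_map_supergradient m : 0 <= m ->
  exists2 s, 0 <= s & forall x, 0 <= x -> energy_map x <= energy_map m + s * (x - m).
Proof.
move=> m0; have mb : 0 < m + b by rewrite ltr_wpDl.
exists (1 - (1 - (b / (m + b)) ^+ 2) / c).
  rewrite subr_ge0 ler_pdivrMr// mul1r (le_trans _ c1)//.
  by rewrite gerBl sqr_ge0.
move=> x x0; have xb : 0 < x + b by rewrite ltr_wpDl.
rewrite /energy_map -subr_ge0.
set t := (X in 0 <= X).
have -> : t = (b * (x - m) / (m + b)) ^+ 2 / (c * (x + b)).
  by rewrite /t; field; rewrite !gt_eqF.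
by rewrite divr_ge0 ?sqr_ge0 ?mulr_ge0// ltW.
Qed.

(** Slopes multiply along the iteration, and their nonnegativity allows the tangent bounds to be
    composed. *)
Lemma iter_energy_map_supergradient t m : 0 <= m ->
  exists2 s, 0 <= s & forall x, 0 <= x ->
    iter t energy_map x <= iter t energy_map m + s * (x - m).
Proof.
elim: t m => [|t IH] m m0.
  by exists 1 => // x x0; rewrite mul1r addrC subrK.
have [s s0 hs] := energy_map_supergradient m0.
have [s' s'0 hs'] := IH _ (energy_map_ge0 m0).
exists (s' * s); first exact: mulr_ge0.
move=> x x0; rewrite !iterSr (le_trans (hs' _ (energy_map_ge0 x0)))//.
by rewrite lerD2l -mulrA ler_wpM2l// lerBlDl hs.
Qed.

Lemma iter_energy_map_mono t x y : 0 <= x -> x <= y ->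
  iter t energy_map x <= iter t energy_map y.
Proof.
move=> x0 xy.
have [s s0 hs] := iter_energy_map_supergradient t (le_trans x0 xy).
by rewrite (le_trans (hs _ x0))// gerDl mulr_ge0_le0// subr_le0.
Qed.

(* A primitive of [(x + b) / x ^ 2], which is the reciprocal of the decrement
   [x - energy_map x] up to the factor [c]. *)
Let potential x : R := ln x - b / x.

(** The potential is concave, so its tangent at [x] bounds it: the slope [(x + b) / x ^ 2] times the
    decrement [x ^ 2 / (c (x + b))] is exactly [1 / c]. *)
Lemma potential_energy_map x : 0 < x ->
  potential (energy_map x) <= potential x - c^-1.
Proof.
move=> x0; set y := energy_map x; have y0 : 0 < y := energy_map_gt0 x0.
have xb : 0 < x + b by rewrite addr_gt0.
have lnyx : ln y <= ln x + (y / x - 1).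
  rewrite -{1}[y](divfK (lt0r_neq0 x0)) lnM ?posrE ?divr_gt0// addrC lerD2l.
  rewrite -{1}[y / x](subrK 1) addrC le_ln1Dx//.
  by rewrite ltrBDl subrr divr_gt0.
have byx : b / x - b * (y - x) / x ^+ 2 <= b / y.
  rewrite -subr_ge0.
  have -> : b / y - (b / x - b * (y - x) / x ^+ 2) = b * (y - x) ^+ 2 / (y * x ^+ 2).
    by field; rewrite !gt_eqF.
  by apply: divr_ge0; apply: mulr_ge0; rewrite ?sqr_ge0//; exact: ltW.
have -> : c^-1 = 1 - y / x - b * (y - x) / x ^+ 2.
  by rewrite /y /energy_map; field; rewrite !gt_eqF.
by rewrite /potential; lra.
Qed.

(** The step count is required only for [x > 0], as 0 is a fixed point; this matters when there are
    no leading eigenvectors. *)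
Lemma iter_energy_map_le t x : 0 <= x ->
  (0 < x -> c * (1 + ln ((x + b) / b)) <= t%:R) -> iter t energy_map x <= b.
Proof.
rewrite le_eqVlt => /predU1P[<- _|x0 /(_ x0) ht].
  rewrite (_ : iter t energy_map 0 = 0) ?(ltW b0)//.
  by elim: t => //= t ->; rewrite /energy_map expr0n mul0r subr0.
have h k : 0 < iter k energy_map x /\
    potential (iter k energy_map x) <= potential x - k%:R / c.
  elim: k => [|k [IH1 IH2]]; first by rewrite mul0r subr0.
  rewrite iterS; split; first exact: energy_map_gt0.
  rewrite (le_trans (potential_energy_map IH1))// -natr1 mulrDl mul1r.
  by rewrite opprD addrA lerD2r.
have [] := h t; set y := iter t _ _ => y0 hy.
(* An iterate above [b] has potential above [ln b - 1], while [t] drops of [1 / c] bring the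
   potential below that. *)
rewrite leNgt; apply/negP => b_lt_y.
have lnby : ln b < ln y by rewrite ltr_ln ?posrE.
have by1 : b / y < 1 by rewrite ltr_pdivrMr// mul1r.
have : 1 + ln ((x + b) / b) <= t%:R / c by rewrite ler_pdivlMr// mulrC.
have xb : 0 < x + b by rewrite addr_gt0.
rewrite ln_div ?posrE// => h1.
have : ln x < ln (x + b) by rewrite ltr_ln ?posrE// ltrDl.
have : 0 < b / x by rewrite divr_gt0.
by move: hy h1 lnby by1; rewrite /potential; lra.
Qed.

End EnergyRecursion.

(** * Energy splitting and the mean trace of the residual *)

Section ExpectedTrace.
Variables (R : realType) (n : nat).
Implicit Types (M U : 'M[R]_n).

Lemma sqr_sum_le (P : pred 'I_n) (x : 'I_n -> R) (c : R) :
  \sum_(i < n | P i) 1 <= c ->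
  (\sum_(i < n | P i) x i) ^+ 2 <= c * \sum_(i < n | P i) x i ^+ 2.
Proof.
move=> Pc.
(* Cauchy-Schwarz against the indicator vector of [P], whose squared norm is the number of
   indices. *)
pose e : 'cV[R]_n := \col_i (P i)%:R.
pose y : 'cV[R]_n := \col_i (if P i then x i else 0).
have := dot_CauchySchwarz e y; rewrite !dotE.
have -> : \sum_i e i 0 * e i 0 = \sum_(i < n | P i) 1.
  rewrite [RHS]big_mkcond; apply: eq_bigr => i _; rewrite !mxE.
  by case: (P i); rewrite ?mulr1 ?mulr0.
have -> : \sum_i e i 0 * y i 0 = \sum_(i < n | P i) x i.
  rewrite [RHS]big_mkcond; apply: eq_bigr => i _; rewrite !mxE.
  by case: (P i); rewrite ?mul1r ?mul0r.
have -> : \sum_i y i 0 * y i 0 = \sum_(i < n | P i) x i ^+ 2.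
  rewrite [RHS]big_mkcond; apply: eq_bigr => i _; rewrite !mxE.
  by case: (P i); rewrite ?mul0r ?expr2.
move/le_trans; apply; apply: ler_wpM2r => //.
by apply: sumr_ge0 => i _; exact: sqr_ge0.
Qed.

Lemma mxtrace_orthonormal M U : U^T *m U = 1%:M ->
  \tr M = \sum_i qform M (col i U).
Proof.
move=> UU; rewrite -[M in LHS]mulmx1 -(mulmx1C UU) mulmxA mxtrace_mulC mulmxA.
by apply: eq_bigr => i _; rewrite colE -qform_conj qform_delta.
Qed.

Variables (U : 'M[R]_n) (P : pred 'I_n).
Hypothesis UU : U^T *m U = 1%:M.

Definition energy M : R := \sum_(i < n | P i) qform M (col i U).
Definition coenergy M : R := \sum_(i < n | ~~ P i) qform M (col i U).

Lemma mxtrace_energy M : \tr M = energy M + coenergy M.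
Proof. by rewrite (mxtrace_orthonormal M UU) (bigID P). Qed.

Lemma energy_ge0 M : psd M -> 0 <= energy M.
Proof. by move=> [_ Mp]; apply: sumr_ge0 => i _. Qed.

Lemma coenergy_ge0 M : psd M -> 0 <= coenergy M.
Proof. by move=> [_ Mp]; apply: sumr_ge0 => i _. Qed.

Lemma coenergy_rp_step M j : coenergy (rp_step M j) <= coenergy M.
Proof. by apply: ler_sum => i _; exact: rp_step_le. Qed.

Lemma dot_col i : dot (col i U) (col i U) = 1.
Proof.
have := congr1 (fun X : 'M[R]_n => X i i) UU; rewrite !mxE eqxx mulr1n => <-.
by rewrite dotE; apply: eq_bigr => j _; rewrite !mxE.
Qed.

Variables (c b : R).
Hypotheses (c1 : 1 <= c) (b0 : 0 < b) (Pc : \sum_(i < n | P i) 1 <= c).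

(** Cauchy-Schwarz is used twice: over the leading indices, which brings in [c], and as
    [(u^T M u) ^ 2 <= |M u| ^ 2] for each unit vector [u]. *)
Lemma mean_energy M : (0 < n)%N -> psd M -> coenergy M <= b ->
  \sum_j pivot_prob M j * energy (rp_step M j) <= energy_map c b (energy M).
Proof.
move=> n0 Mp Mb.
have c0 : 0 < c := lt_le_trans ltr01 c1.
under eq_bigr do rewrite mulr_sumr.
rewrite exchange_big /=; under eq_bigr do rewrite rpc_mean_qform//.
rewrite sumrB -/(energy M) lerD2l lerN2 -mulr_suml.
have [M0|Mn0] := eqVneq (\tr M) 0.
  have : energy M == 0.
    rewrite eq_le energy_ge0// andbT -M0 mxtrace_energy lerDl.
    exact: coenergy_ge0.
  by move=> /eqP ->; rewrite M0 expr0n mul0r invr0 mulr0.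
have trM : 0 < \tr M by rewrite lt_def Mn0 psd_tr_ge0.
have Eb : 0 < energy M + b by rewrite ltr_wpDl// energy_ge0.
apply: (@le_trans _ _ (energy M ^+ 2 / (c * \tr M))).
  rewrite ler_wpM2l ?sqr_ge0// lef_pV2 ?posrE ?mulr_gt0//.
  by rewrite ler_pM2l// mxtrace_energy lerD2l.
rewrite invfM mulrA ler_pM2r ?invr_gt0// ler_pdivrMr// mulrC.
apply: (le_trans (sqr_sum_le _ Pc)); rewrite ler_pM2l//; apply: ler_sum => i _.
rewrite qformE (le_trans (dot_CauchySchwarz _ _))//.
by rewrite dot_col mul1r.
Qed.

Lemma mean_trace_le t M : (t <= n)%N -> psd M -> coenergy M <= b ->
  rpc_E (@mxtrace R n) t M <= b + iter t (energy_map c b) (energy M).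
Proof.
elim: t M => [|t IH] M tn Mp Mb.
  by rewrite /= mxtrace_energy addrC lerD2r.
have n0 : (0 < n)%N by case: n tn.
rewrite iterSr.
set m := \sum_j pivot_prob M j * energy (rp_step M j).
have m0 : 0 <= m.
  apply: sumr_ge0 => j _; rewrite mulr_ge0 ?pivot_prob_ge0//.
  by rewrite energy_ge0//; exact: psd_rp_step.
(* Jensen's inequality: the tangent is taken at the mean [m], so its linear term averages to zero
   over the first pivot. *)
have [s s0 hs] := iter_energy_map_supergradient c1 b0 t m0.
have hm : iter t (energy_map c b) m <=
    iter t (energy_map c b) (energy_map c b (energy M)).
  by apply: iter_energy_map_mono => //; exact: mean_energy.
rewrite /=; apply: (@le_trans _ _ (\sum_j pivot_prob M j *
   (b + (iter t (energy_map c b) m + s * (energy (rp_step M j) - m))))).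
  apply: ler_sum => j _; rewrite ler_wpM2l ?pivot_prob_ge0//.
  have Mj := psd_rp_step j Mp.
  rewrite (le_trans (IH _ (ltnW tn) Mj _))//.
    exact: le_trans (coenergy_rp_step M j) Mb.
  by rewrite lerD2l hs// energy_ge0.
under eq_bigr => j _.
  rewrite (_ : _ * _ = pivot_prob M j * (b + iter t (energy_map c b) m - s * m)
    + s * (pivot_prob M j * energy (rp_step M j))); last by ring.
  over.
rewrite big_split /= -mulr_suml -mulr_sumr sum_pivot_prob// -/m mul1r subrK.
by rewrite lerD2l.
Qed.

End ExpectedTrace.

(** * Preconditioned conjugate gradient *)

Section Chebyshev.
Variable (R : realType).
Implicit Types (x w v : R).

Fixpoint cheb (k : nat) x : R :=
  if k is k1.+1 then
    if k1 is k2.+1 then 2 * x * cheb k1 x - cheb k2 x else x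
  else 1.

Lemma chebSS k x : cheb k.+2 x = 2 * x * cheb k.+1 x - cheb k x.
Proof. by []. Qed.

(** The left side is an invariant of the recurrence. It amounts to [(T_(k+1) - x T_k) ^ 2 = (1 - x ^
    2) (1 - T_k ^ 2)]. *)
Lemma cheb_Pell k x :
  cheb k.+1 x ^+ 2 + cheb k x ^+ 2 - 2 * x * cheb k x * cheb k.+1 x = 1 - x ^+ 2.
Proof.
elim: k => [|k <-]; first by rewrite /=; ring.
by rewrite chebSS; ring.
Qed.

(** Inside the interval the invariant is divided by [1 - x ^ 2]; at the endpoints it degenerates to
    [T_(k+1) = x T_k]. *)
Lemma cheb_le1 k x : x ^+ 2 <= 1 -> cheb k x ^+ 2 <= 1.
Proof.
rewrite le_eqVlt => /predU1P[x1|x1].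
  have step j : cheb j.+1 x = x * cheb j x.
    apply/eqP; rewrite -subr_eq0 -sqrf_eq0; apply/eqP.
    have -> : (cheb j.+1 x - x * cheb j x) ^+ 2 = cheb j.+1 x ^+ 2
        + cheb j x ^+ 2 - 2 * x * cheb j x * cheb j.+1 x
        + (x ^+ 2 - 1) * cheb j x ^+ 2 by ring.
    by rewrite cheb_Pell x1 subrr mul0r addr0.
  elim: k => [|k IH]; first by rewrite expr1n.
  by rewrite step exprMn x1 mul1r.
have := cheb_Pell k x => h.
have h2 : (1 - x ^+ 2) * (1 - cheb k x ^+ 2) = (cheb k.+1 x - x * cheb k x) ^+ 2.
  by rewrite mulrBr mulr1 -[X in X - _]h; ring.
rewrite -subr_ge0 -(@pmulr_rge0 _ (1 - x ^+ 2)) ?subr_gt0// h2.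
exact: sqr_ge0.
Qed.

(** Both [w] and [v] are roots of [y ^ 2 = (w + v) y - 1], the characteristic equation of the
    recurrence. *)
Lemma cheb_half_sum k w v : w * v = 1 ->
  cheb k ((w + v) / 2) = (w ^+ k + v ^+ k) / 2.
Proof.
move=> wv.
suff [] : cheb k ((w + v) / 2) = (w ^+ k + v ^+ k) / 2 /\
          cheb k.+1 ((w + v) / 2) = (w ^+ k.+1 + v ^+ k.+1) / 2 by [].
elim: k => [|k [IH1 IH2]].
  by split; rewrite /= ?expr0 ?expr1//; field.
split => //; rewrite chebSS IH1 IH2 !exprS.
have -> : w ^+ k + v ^+ k = (w * v) * (w ^+ k + v ^+ k) by rewrite wv mul1r.
by field.
Qed.

End Chebyshev.

(** The vector [T_k(Z) e], built by the recurrence of [cheb] so that both unfold in parallel. *)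
Fixpoint chebv (R : realType) (n : nat) (Z : 'M[R]_n) (k : nat) (e : 'cV[R]_n) :=
  if k is k1.+1 then
    if k1 is k2.+1 then 2 *: (Z *m chebv Z k1 e) - chebv Z k2 e else Z *m e
  else e.

Lemma chebvSS (R : realType) (n : nat) (Z : 'M[R]_n) k e :
  chebv Z k.+2 e = 2 *: (Z *m chebv Z k.+1 e) - chebv Z k e.
Proof. by []. Qed.

(** * Orthogonality and polynomial optimality of PCG *)

Section PCG.
Variables (R : realType) (n : nat) (A P : 'M[R]_n) (b : 'cV[R]_n).
Local Notation B := (invmx P).
Hypotheses (AT : A^T = A) (BT : B^T = B).
Hypothesis Apos : forall x, x != 0 -> 0 < qform A x.
Hypothesis Bpos : forall x, x != 0 -> 0 < qform B x.

Local Notation sol t := (pcg_iter A P b t).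
Let res t := (pcg_state A P b t).1.1.2.
Let z t := (pcg_state A P b t).1.2.
Let p t := (pcg_state A P b t).2.
Let alpha t := dot (res t) (z t) / qform A (p t).
Let beta t := dot (res t.+1) (z t.+1) / dot (res t) (z t).

Let solS t : sol t.+1 = sol t + alpha t *: p t.
Proof. by rewrite /pcg_iter /alpha /res /z /p /=; case: pcg_state => [[[]]]. Qed.

Let resS t : res t.+1 = res t - alpha t *: (A *m p t).
Proof. by rewrite /alpha /res /z /p /=; case: pcg_state => [[[]]]. Qed.

Let zE t : z t = B *m res t.
Proof. by case: t => [//|t]; rewrite /z /res /=; case: pcg_state => [[[]]]. Qed.

Let pS t : p t.+1 = z t.+1 + beta t *: p t.
Proof. by rewrite /beta /res /z /p /=; case: pcg_state => [[[]]]. Qed.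

Let resE t : res t = b - A *m sol t.
Proof.
elim: t => [|t IH]; first by rewrite mulmx0 subr0.
by rewrite resS solS IH mulmxDr -scalemxAr opprD addrA.
Qed.

Let res_eq0S t : res t = 0 -> res t.+1 = 0.
Proof. by move=> r0; rewrite resS /alpha r0 dot0l mul0r scale0r subr0. Qed.

Let res_neq0 i t : (i <= t)%N -> res t != 0 -> res i != 0.
Proof.
move=> it; apply: contra_neq => ri.
by rewrite -(subnK it); elim: (t - i)%N => // k; exact: res_eq0S.
Qed.

Let dot_z_res i j : dot (z i) (res j) = dot (res i) (z j).
Proof. by rewrite !zE dot_mulmxl BT. Qed.

Let dot_res_z_gt0 t : res t != 0 -> 0 < dot (res t) (z t).
Proof. by rewrite zE -qformE; exact: Bpos. Qed.

(** The identity on [dot (res t) (p t)] forces [p t] to be nonzero. *)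
Let alpha_gt0 t : res t != 0 -> dot (res t) (p t) = dot (res t) (z t) ->
  0 < alpha t /\ 0 < qform A (p t).
Proof.
move=> rt rp; have rz := dot_res_z_gt0 rt.
have q0 : 0 < qform A (p t).
  by apply: Apos; apply: contraTneq rz; rewrite -rp => ->; rewrite dot0r ltxx.
by rewrite /alpha divr_gt0.
Qed.

Let A_p t : alpha t != 0 -> A *m p t = (alpha t)^-1 *: (res t - res t.+1).
Proof. by move=> at0; rewrite resS opprB addrC subrK scalerA mulVf// scale1r. Qed.

(** The four families of relations need each other and are proved in one induction; a nonzero
    residual keeps every earlier [alpha] positive. *)
Let pcg_orthogonality t : res t != 0 ->
  [/\ forall i, (i < t)%N -> dot (res t) (p i) = 0,
      forall i, (i < t)%N -> dot (res t) (z i) = 0,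
      forall i, (i < t)%N -> dot (p t) (A *m p i) = 0 &
      forall i, (i <= t)%N -> dot (res i) (p i) = dot (res i) (z i)].
Proof.
elim: t => [|t IH] rS.
  by split => // i; rewrite leqn0 => /eqP ->.
have rt := res_neq0 (leqnSn t) rS.
have [IH1 IH2 IH3 IH4] := IH rt.
have al i : (i <= t)%N -> 0 < alpha i /\ 0 < qform A (p i).
  by move=> it; apply: alpha_gt0; [exact: res_neq0 it rt | exact: IH4].
have [_ qt] := al t (leqnn t).
have rz := dot_res_z_gt0 rt.
have H1 i : (i < t.+1)%N -> dot (res t.+1) (p i) = 0.
  rewrite ltnS leq_eqVlt resS dotBl dotZl dot_sym// => /predU1P[->|it].
    by rewrite IH4// /alpha -qformE divfK ?subrr// gt_eqF.
  by rewrite IH1// IH3// mulr0 subr0.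
have H2 i : (i < t.+1)%N -> dot (res t.+1) (z i) = 0.
  case: i => [it|i it]; first exact: (H1 0%N).
  have -> : z i.+1 = p i.+1 - beta i *: p i by rewrite pS addrK.
  by rewrite dotBr dotZr !H1 ?mulr0 ?subr0// ltnW.
have H3 i : (i < t.+1)%N -> dot (p t.+1) (A *m p i) = 0.
  move=> it; have [ai _] := al i it.
  (* With [A p_i] written as a difference of residuals, the only term left from [z t.+1] occurs at
     [i = t], where [beta t] cancels it. *)
  rewrite pS dotDl dotZl {1}A_p ?gt_eqF// dotZr dotBr !dot_z_res H2// sub0r.
  move: it; rewrite ltnS leq_eqVlt => /predU1P[->|it].
    by rewrite -qformE /beta /alpha invf_div; field; rewrite !gt_eqF.
  by rewrite H2// IH3// oppr0 !mulr0 addr0.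
split => // i; rewrite leq_eqVlt => /predU1P[->|]; last exact: IH4.
by rewrite pS dotDr dotZr H1// mulr0 addr0.
Qed.

(* Membership in the span of the first [k] search directions, expressed by
   duality. *)
Let krylov k (v : 'cV[R]_n) : Prop :=
  forall w, (forall i, (i < k)%N -> dot w (p i) = 0) -> dot w v = 0.

Let krylovD k u v : krylov k u -> krylov k v -> krylov k (u + v).
Proof. by move=> hu hv w wp; rewrite dotDr hu// hv// addr0. Qed.

Let krylovZ k a v : krylov k v -> krylov k (a *: v).
Proof. by move=> hv w wp; rewrite dotZr hv// mulr0. Qed.

Let krylovW k k' v : (k <= k')%N -> krylov k v -> krylov k' v.
Proof. by move=> kk hv w wp; apply: hv => i ik; rewrite wp// (leq_trans ik). Qed.

Let krylov_p i k : (i < k)%N -> krylov k (p i).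
Proof. by move=> ik w; exact. Qed.

Let krylov_z i k : (i < k)%N -> krylov k (z i).
Proof.
case: i => [|i] ik; first exact: (@krylov_p 0).
have -> : z i.+1 = p i.+1 + (- beta i) *: p i by rewrite pS scaleNr addrK.
by apply: krylovD; [exact: krylov_p | apply/krylovZ/krylov_p/ltnW].
Qed.

Let krylov_sol t : krylov t (sol t).
Proof.
elim: t => [|t IH]; first by move=> w _; rewrite dot0r.
rewrite solS; apply: krylovD; first exact: krylovW IH.
exact/krylovZ/krylov_p.
Qed.

(** Self-adjointness moves [A] and [B] onto the test vector and then onto [p i]; [B A p_i] is a
    multiple of [z_i - z_(i+1)], which lies in the larger space. *)
Let krylovBA t k v : res t != 0 -> (k <= t)%N ->
  krylov k v -> krylov k.+1 (B *m (A *m v)).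
Proof.
move=> rt kt hv w wp.
rewrite -(dot_sym w (A *m v) BT) -(dot_sym (B *m w) v AT).
apply: hv => i ik; rewrite !dot_sym//.
have [_ _ _ rp] := pcg_orthogonality rt.
have it : (i <= t)%N by rewrite (leq_trans _ kt)// ltnW.
have [ai _] := alpha_gt0 (res_neq0 it rt) (rp i it).
rewrite A_p ?gt_eqF// -scalemxAr mulmxBr -!zE dotZr dotBr.
by rewrite !(krylov_z _ wp) ?subr0 ?mulr0// ltnS ltnW.
Qed.

Variables (g h : R).
(** An affine image of [B A], chosen later to send the spectrum into [[-1, 1]]; it sends 0 to [g],
    hence the normalising factor [cheb t g]. *)
Let Z : 'M[R]_n := g%:M - h *: (B *m A).

Local Notation chebv := (chebv Z).

Let ZE (v : 'cV[R]_n) : Z *m v = g *: v + (- h) *: (B *m (A *m v)).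
Proof. by rewrite mulmxBl mul_scalar_mx -scalemxAl mulmxA scaleNr. Qed.

Variable e0 : 'cV[R]_n.
Hypothesis Ae0 : A *m e0 = b.

(** The polynomial [T_k(g - h X) - T_k(g)] has no constant term, and [B A e0 = z 0] starts the
    Krylov space. *)
Let krylov_chebv t k : res t != 0 -> (k <= t)%N ->
  krylov k (chebv k e0 - cheb k g *: e0).
Proof.
move=> rt kt.
have Ze0 : Z *m e0 = g *: e0 + (- h) *: z 0 by rewrite ZE Ae0 zE.
suff [] : krylov k (chebv k e0 - cheb k g *: e0) /\ ((k < t)%N ->
    krylov k.+1 (chebv k.+1 e0 - cheb k.+1 g *: e0)) by [].
elim: k kt => [|k IH] kt.
  split; first by move=> w _; rewrite /= scale1r subrr dot0r.
  move=> t0; rewrite /= Ze0 addrC addKr; apply: krylovZ; exact: krylov_z.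
have [IH1 IH2] := IH (ltnW kt).
have {}IH2 := IH2 kt.
split => // kt2; rewrite chebvSS chebSS.
set c1 := chebv k.+1 e0 in IH2 *; set c := chebv k e0 in IH1 *.
have -> : 2 *: (Z *m c1) - c - (2 * g * cheb k.+1 g - cheb k g) *: e0 =
    (2 * g) *: (c1 - cheb k.+1 g *: e0)
    + (- (2 * h)) *: (B *m (A *m (c1 - cheb k.+1 g *: e0)))
    + (- (2 * h * cheb k.+1 g)) *: z 0 + (-1) *: (c - cheb k g *: e0).
  rewrite ZE !mulmxBr -!scalemxAr Ae0 zE.
  apply/matrixP => i j; rewrite !mxE; ring.
apply: krylovD; last by apply: krylovZ; apply: krylovW IH1; rewrite ltnW.
apply: krylovD; last exact/krylovZ/krylov_z.
apply: krylovD; first by apply: krylovZ; exact: krylovW IH2.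
by apply: krylovZ; exact: (krylovBA rt).
Qed.

(* The residual is orthogonal to the Krylov space, which contains both [sol t]
   and [chebv t e0 - cheb t g *: e0]. *)
Lemma pcg_error_chebv t :
  cheb t g ^+ 2 * qform A (sol t - e0) <= qform A (chebv t e0).
Proof.
have rE : res t = - (A *m (sol t - e0)) by rewrite resE mulmxBr Ae0 opprB.
have [r0|rt] := eqVneq (res t) 0.
  have -> : sol t - e0 = 0.
    apply/eqP; apply: contraT => /Apos; rewrite qformE.
    have : A *m (sol t - e0) = 0 by apply/eqP; rewrite -oppr_eq0 -rE r0.
    by move=> ->; rewrite dot0r ltxx.
  rewrite qformE dot0l mulr0; have [->|/Apos/ltW//] := eqVneq (chebv t e0) 0.
  by rewrite qformE dot0l.
have [rp _ _ _] := pcg_orthogonality rt.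
have h1 : dot (res t) (chebv t e0) = cheb t g * dot (res t) e0.
  by apply/eqP; rewrite -dotZr -subr_eq0 -dotBr (krylov_chebv rt (leqnn t) rp).
have h2 : dot (res t) e0 = qform A (sol t - e0).
  transitivity (- dot (res t) (sol t - e0)).
    by rewrite dotBr (krylov_sol rp) sub0r opprK.
  by rewrite rE dotNl opprK qformE dotC.
have Ap : psd A.
  split => // x; have [->|/Apos/ltW//] := eqVneq x 0.
  by rewrite qformE dot0l.
have q0 : 0 < qform A (sol t - e0).
  apply: Apos; apply: contra_neq rt => h0; rewrite rE h0 mulmx0 oppr0.
  by [].
rewrite -(ler_pM2l q0).
have := psd_CauchySchwarz (sol t - e0) (chebv t e0) Ap.
rewrite -dot_sym//; apply: le_trans.
have -> : dot (A *m (sol t - e0)) (chebv t e0) = - (cheb t g * qform A (sol t - e0)).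
  by rewrite -h2 -h1 rE dotNl opprK.
by rewrite sqrrN exprMn mulrCA -expr2.
Qed.

(** In the coordinates [W], both the form [A] and the operator [B A] are diagonal, so coordinate [i]
    is scaled by [T_k(g - h D_i)], of modulus at most 1. *)
Lemma qform_chebv (W : 'M[R]_n) (D : 'I_n -> R) k e :
  (forall i, 0 <= D i) ->
  (forall x, qform A x = \sum_i D i * (W *m x) i 0 ^+ 2) ->
  (forall (x : 'cV[R]_n) i, (W *m (B *m (A *m x))) i 0 = D i * (W *m x) i 0) ->
  (forall i, (g - h * D i) ^+ 2 <= 1) ->
  qform A (chebv k e) <= qform A e.
Proof.
move=> D0 qA WBA gh; rewrite !qA; apply: ler_sum => i _.
have WZ (x : 'cV[R]_n) : (W *m (Z *m x)) i 0 = (g - h * D i) * (W *m x) i 0.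
  rewrite ZE mulmxDr -!scalemxAr mxE [X in X + _]mxE [X in _ + X]mxE WBA; ring.
have -> : (W *m chebv k e) i 0 = cheb k (g - h * D i) * (W *m e) i 0.
  suff [] : (W *m chebv k e) i 0 = cheb k (g - h * D i) * (W *m e) i 0 /\
    (W *m chebv k.+1 e) i 0 = cheb k.+1 (g - h * D i) * (W *m e) i 0 by [].
  elim: k => [|k [IH1 IH2]]; first by rewrite /= mul1r WZ.
  split => //; rewrite chebvSS chebSS mulmxBr -scalemxAr mxE [X in X + _]mxE.
  rewrite [X in _ + X]mxE WZ IH2 IH1; ring.
rewrite ler_wpM2l// exprMn ler_piMl ?sqr_ge0//; exact: cheb_le1.
Qed.

End PCG.

(** * Square roots and preconditioning *)

Section SpectralConsequences.
Variables (R : realType) (n : nat).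
Implicit Types (M U : 'M[R]_n) (s : seq R).

Lemma eigdecP M : M^T = M -> spec_decomp M (eigdec M).
Proof. by move=> MT; apply: xgetPex; exact: exists_spec_decomp. Qed.

Lemma qform_spec M Us x : spec_decomp M Us ->
  qform M x = \sum_(i < n) Us.2`_i * (Us.1^T *m x) i 0 ^+ 2.
Proof.
case=> _ _ _ ->; have := qform_conj (diag_mx (\row_i Us.2`_i)) Us.1^T x.
rewrite trmxK => ->; rewrite qformE dotE.
apply: eq_bigr => i _; rewrite mul_diag_mx !mxE; ring.
Qed.

Lemma eig_qform M Us (i : 'I_n) : spec_decomp M Us -> qform M (col i Us.1) = Us.2`_i.
Proof.
move=> dec; rewrite (qform_spec _ dec); have [UU _ _ _] := dec.
rewrite colE mulmxA UU mul1mx (bigD1 i)//= mxE !eqxx expr1n mulr1 big1 ?addr0//.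
by move=> j ji; rewrite mxE (negbTE ji) expr0n mulr0.
Qed.

(** [msqrt] is a chosen root, so exhibiting one from a spectral decomposition suffices. *)
Lemma msqrtP M : psd M -> psd (msqrt M) /\ msqrt M *m msqrt M = M.
Proof.
move=> Mp; have [MT Mge] := Mp.
pose goodS := [set S | psd S /\ S *m S = M]%classic.
apply: (@xgetPex _ 0 goodS); rewrite /goodS /=.
have [[U s] dec] := exists_spec_decomp MT; have [/= UU _ _ ME] := dec.
pose E : 'rV[R]_n := \row_i Num.sqrt s`_i.
have Dge (i : 'I_n) : 0 <= s`_i by rewrite -(eig_qform i dec).
exists (U *m diag_mx E *m U^T); split.
  split=> [|x]; first by rewrite !trmx_mul trmxK tr_diag_mx mulmxA.
  have := qform_conj (diag_mx E) U^T x; rewrite trmxK => ->.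
  rewrite qformE dotE sumr_ge0// => i _.
  rewrite mul_diag_mx !mxE mulrCA -expr2 mulr_ge0 ?sqrtr_ge0 ?sqr_ge0//.
rewrite ME -!mulmxA (mulmxA U^T) UU mul1mx (mulmxA (diag_mx E)) mulmx_diag.
congr (_ *m (diag_mx _ *m _)); apply/rowP => i.
by rewrite !mxE -expr2 sqr_sqrtr.
Qed.

(** With [M = S S], Cauchy-Schwarz bounds [|S x| ^ 2] row by row, and the squared row norms of [S]
    sum to the trace. *)
Lemma qform_le_trace M x : psd M -> qform M x <= \tr M * dot x x.
Proof.
move=> Mp; have [[ST _] SS] := msqrtP Mp; set S := msqrt M in ST SS.
rewrite -SS qformE -mulmxA -[S in X in dot x (X *m _)]ST -dot_mulmxl dotE.
rewrite mulr_suml; apply: ler_sum => i _.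
have Sij j : S i j = S j i by rewrite -[in LHS]ST mxE.
have -> : (S *m x) i 0 = dot (col i S) x.
  by rewrite dotE mxE; apply: eq_bigr => j _; rewrite mxE Sij.
have -> : (S *m S) i i = dot (col i S) (col i S).
  by rewrite dotE mxE; apply: eq_bigr => j _; rewrite !mxE Sij.
by rewrite -expr2 dot_CauchySchwarz.
Qed.

Lemma posdef_unitmx M : (forall x, x != 0 -> 0 < qform M x) -> M \in unitmx.
Proof.
move=> Mpos; rewrite unitmxE unitfE; apply/negP => /det0P [v v0 vM].
have vT0 : v^T != 0 by rewrite -(inj_eq (@trmx_inj _ _ _)) trmxK trmx0.
by have := Mpos _ vT0; rewrite /qform trmxK vM mul0mx mxE ltxx.
Qed.

End SpectralConsequences.

(** * Spectrum and PCG error for a preconditioner with [P <= A <= k P] *)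

Section Preconditioning.
Variables (R : realType) (n : nat) (A P : 'M[R]_n) (k : R).
Hypotheses (AT : A^T = A) (PT : P^T = P).
Hypothesis Ppos : forall x, x != 0 -> 0 < qform P x.
Hypothesis PA : forall x, qform P x <= qform A x.
Hypothesis AP : forall x, qform A x <= k * qform P x.

Let Pp : psd P.
Proof.
split => // x; have [->|/Ppos/ltW//] := eqVneq x 0.
by rewrite qformE dot0l.
Qed.

Let S := msqrt P.
Let ST : S^T = S. Proof. by have [[]] := msqrtP Pp. Qed.
Let SS : S *m S = P. Proof. by have [] := msqrtP Pp. Qed.

Let Pu : P \in unitmx. Proof. exact: posdef_unitmx. Qed.

Let Su : S \in unitmx.
Proof. by have := Pu; rewrite -SS unitmx_mul andbb. Qed.

Let N := minvsqrt P *m A *m minvsqrt P.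

Let ST' : (minvsqrt P)^T = minvsqrt P.
Proof. by rewrite /minvsqrt trmx_inv ST. Qed.

Let NT : N^T = N.
Proof. by rewrite /N !trmx_mul ST' AT mulmxA. Qed.

Let qN x : qform N x = qform A (minvsqrt P *m x).
Proof. by rewrite -qform_conj ST'. Qed.

Let qP x : dot x x = qform P (minvsqrt P *m x).
Proof.
rewrite -qform_conj ST' -{2}SS /minvsqrt -/S mulKmx// mulmxV//.
by rewrite qform_scalar mul1r.
Qed.

Let Nge x : dot x x <= qform N x.
Proof. by rewrite qN qP. Qed.

Let Nle x : qform N x <= k * dot x x.
Proof. by rewrite qN qP. Qed.

(** The substitution of [P^(-1/2) x] for [x] turns [P <= A <= k P] into bounds on the form [N] at
    unit eigenvectors. *)
Lemma precond_eig Us (i : 'I_n) : spec_decomp N Us -> 1 <= Us.2`_i <= k.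
Proof.
move=> dec; rewrite -(eig_qform i dec); have [UU _ _ _] := dec.
have u1 : dot (col i Us.1) (col i Us.1) = 1.
  have := congr1 (fun X : 'M[R]_n => X i i) UU; rewrite !mxE eqxx mulr1n => <-.
  by rewrite dotE; apply: eq_bigr => j _; rewrite !mxE.
have := Nge (col i Us.1); have := Nle (col i Us.1).
by rewrite u1 mulr1 => -> ->.
Qed.

Lemma precond_kappa : 0 <= k -> kappa N <= k.
Proof.
move=> k0; rewrite /kappa /eig.
have dec := eigdecP NT; have [_ szE _ _] := dec.
(* In dimension 0 the list of eigenvalues is empty and [kappa] takes the default value 0. *)
have [n0|n0] := posnP n.
  by rewrite nth_default ?szE ?n0// mul0r.
have n1 : (n.-1 < n)%N by rewrite prednK.
have /andP[_ h0] := precond_eig (Ordinal n0) dec.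
have /andP[h1 _] := precond_eig (Ordinal n1) dec.
rewrite ler_pdivrMr ?(lt_le_trans ltr01 h1)//.
by rewrite (le_trans h0)// ler_peMr.
Qed.

Lemma precond_pcg (b : 'cV[R]_n) t : 1 < k ->
  cheb t ((k + 1) / (k - 1)) ^+ 2 * qform A (pcg_iter A P b t - invmx A *m b)
    <= qform A (invmx A *m b).
Proof.
move=> k1.
have Apos x : x != 0 -> 0 < qform A x.
  by move=> x0; apply: lt_le_trans (PA x); exact: Ppos.
have Au := posdef_unitmx Apos.
have BT : (invmx P)^T = invmx P by rewrite trmx_inv PT.
have Bpos x : x != 0 -> 0 < qform (invmx P) x.
  move=> x0; have y0 : invmx P *m x != 0.
    by apply: contra_neq x0 => h; rewrite -(mulKVmx Pu x) h mulmx0.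
  have := Ppos y0; rewrite -qform_conj BT -mulmxA mulmxV// mulmx1.
  by [].
have [[U s] dec] := exists_spec_decomp NT.
have sk (i : 'I_n) : 1 <= s`_i <= k := precond_eig i dec.
have k10 : 0 < k - 1 by rewrite subr_gt0.
apply: (le_trans (pcg_error_chebv AT BT Apos Bpos _ (2 / (k - 1)) _ _)).
  by rewrite mulKVmx.
have SV : S *m minvsqrt P = 1%:M by rewrite /minvsqrt -/S mulmxV.
have VS : minvsqrt P *m S = 1%:M by rewrite /minvsqrt -/S mulVmx.
have AE : A = S *m N *m S.
  by rewrite /N !mulmxA SV mul1mx -mulmxA VS mulmx1.
have BE : invmx P = minvsqrt P *m minvsqrt P.
  have SVV : S *m S *m (minvsqrt P *m minvsqrt P) = 1%:M.
    by rewrite -mulmxA (mulmxA S (minvsqrt P)) SV mul1mx SV.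
  by apply: (can_inj (mulKmx Pu)); rewrite mulmxV// -{1}SS SVV.
have [/= UU _ _ NE] := dec.
(* As [A = S N S] and [B A = S^-1 N S], the coordinates [U^T S] diagonalise both. *)
apply: (@qform_chebv _ _ _ _ _ _ (U^T *m S) (fun i => s`_i)).
- by move=> i; have /andP[+ _] := sk i; exact: le_trans ler01.
- move=> x; rewrite {1}AE -{1}ST qform_conj (qform_spec _ dec).
  by apply: eq_bigr => i _; rewrite mulmxA.
- move=> x i; move: NE AE; move: N => M NE AE; rewrite BE {1}AE -!mulmxA.
  rewrite (mulmxA S (minvsqrt P)) SV mul1mx.
  rewrite (mulmxA (minvsqrt P) S) VS mul1mx {1}NE -!mulmxA (mulmxA U^T U) UU mul1mx.
  by rewrite mul_diag_mx !mxE.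
- move=> i; have /andP[s1 s2] := sk i.
  have -> : (k + 1) / (k - 1) - 2 / (k - 1) * s`_i = (k + 1 - 2 * s`_i) / (k - 1).
    by field; rewrite gt_eqF.
  rewrite exprMn exprVn ler_pdivrMr ?exprn_gt0// mul1r -subr_ge0.
  have -> : (k - 1) ^+ 2 - (k + 1 - 2 * s`_i) ^+ 2 = 4 * ((s`_i - 1) * (k - s`_i)).
    by ring.
  by rewrite mulr_ge0// mulr_ge0 ?subr_ge0.
Qed.

End Preconditioning.

(** * Growth of the Chebyshev polynomials *)

Section ConvergenceRate.
Variable (R : realType).

(** At [x = sqrt delta] the ratio is [(sqrt k + 1) / (sqrt k - 1)] for [k = 3 / delta]. The proof
    bounds [exp (- x)] below by [(1 - x / 3) ^ 3]. *)
Lemma expR_le_ratio (x : R) : 0 <= x -> x <= 1 ->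
  expR x <= (Num.sqrt 3 + x) / (Num.sqrt 3 - x).
Proof.
move=> x0 x1; set s := Num.sqrt 3.
have s3 : s ^+ 2 = 3 by rewrite sqr_sqrtr.
have s0 : 0 <= s by exact: sqrtr_ge0.
have s17 : 17 / 10 <= s by rewrite leNgt; apply/negP => h; nra.
have sx : 0 < s - x by lra.
pose y := x / 3; have xy : x = 3 * y by rewrite /y; field.
have y0 : 0 <= y by rewrite /y; lra.
have y1 : y <= 1 / 3 by rewrite /y; lra.
have e0 : 1 - y <= expR (- y) by have := expR_ge1Dx (- y).
(* The exponent 3 matters: with [(1 - x / 2) ^ 2] in place of [(1 - x / 3) ^ 3]
   the polynomial inequality [key] fails on part of [0, 1]. *)
have e3 : (1 - y) ^+ 3 <= expR (- x).
  rewrite (_ : - x = 3%:R * - y); last by rewrite xy mulrN.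
  by rewrite expRM_natl lerXn2r// nnegrE ?expR_ge0//; lra.
have key : (s - x) <= (1 - y) ^+ 3 * (s + x).
  have sy : s * s = 3 by rewrite -expr2.
  have q : 0 <= (2 * s - 3) + y * (3 - 3 * s) + y ^+ 2 * (3 * s - 1) - s * y ^+ 3.
    have : 0 <= y ^+ 2 * (1 / 3 - y) by rewrite mulr_ge0 ?sqr_ge0// subr_ge0.
    nra.
  have -> : (1 - y) ^+ 3 * (s + x) = s - x +
    s * y * ((2 * s - 3) + y * (3 - 3 * s) + y ^+ 2 * (3 * s - 1) - s * y ^+ 3)
    + (s ^+ 2 - 3) * (y * (3 * y - 2 - 3 * y ^+ 2 + y ^+ 3)).
    rewrite xy; ring.
  by rewrite s3 subrr mul0r addr0 lerDl !mulr_ge0.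
rewrite ler_pdivlMr// -[x in expR x]opprK expRN mulrC ler_pdivrMr ?expR_gt0//.
by rewrite mulrC (le_trans key)// ler_wpM2r//; lra.
Qed.

Lemma cheb_rate (delta eps : R) t : 0 < delta < 1 -> 0 < eps ->
  (Num.sqrt delta)^-1 * ln (2 / eps) <= t%:R ->
  eps^-1 <= cheb t ((3 / delta + 1) / (3 / delta - 1)).
Proof.
move=> /andP[d0 d1] e0 ht.
set x := Num.sqrt delta in ht; set s : R := Num.sqrt 3.
have x0 : 0 < x by rewrite sqrtr_gt0.
have xx : x ^+ 2 = delta by rewrite sqr_sqrtr// ltW.
have x1 : x < 1 by rewrite -(@expr_lt1 _ 2) ?xx// ltW.
have s1 : 1 < s by rewrite -[ltLHS]sqrtr1 ltr_sqrt ?ltr1n.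
have ss : s ^+ 2 = 3 by rewrite sqr_sqrtr.
have sx : 0 < s - x by rewrite subr_gt0 (lt_trans x1).
have sx' : 0 < s + x by rewrite addr_gt0// (lt_trans ltr01).
(* The argument is the half-sum of a ratio and its inverse, so [cheb] is explicit; the inverse power
   is then dropped, at the cost of the 2 in [2 / eps]. *)
have -> : (3 / delta + 1) / (3 / delta - 1) =
    ((s + x) / (s - x) + (s - x) / (s + x)) / 2.
  rewrite -xx -ss; field.
  by rewrite !gt_eqF//= mulN1r subr_sqr mulr_gt0.
rewrite cheb_half_sum; last by field; rewrite !gt_eqF.
apply: (@le_trans _ _ (((s + x) / (s - x)) ^+ t / 2)); last first.
  by rewrite ler_pM2r// lerDl exprn_ge0// divr_ge0// ltW.
rewrite ler_pdivlMr// mulrC.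
apply: (@le_trans _ _ (expR x ^+ t)); last first.
  by rewrite lerXn2r ?nnegrE ?expR_ge0 ?divr_ge0 ?expR_le_ratio// ltW.
rewrite -expRM_natr -[leLHS]lnK ?posrE ?divr_gt0// ler_expR.
by rewrite -ler_pdivrMl.
Qed.

End ConvergenceRate.

(** * Expected trace of the residual *)

Section Assembly.
Variables (R : realType) (n : nat).
Implicit Types (K : 'M[R]_n).

Lemma tail_rankP K (mu : R) : 0 <= mu ->
  (tail_rank K mu <= n)%N /\
  \sum_(i < n | ~~ (i < tail_rank K mu)%N) (eig K)`_i <= mu.
Proof.
move=> mu0; set a := fun t : nat => \sum_(t <= i < n) (eig K)`_i <= mu.
have ha : has a (iota 0 n.+1).
  (* At [t = n] the tail sum is empty, so the search succeeds. *)
  by apply/hasP; exists n; rewrite ?mem_iota ?leqnn// /a big_geq.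
have l_le_n : (tail_rank K mu <= n)%N.
  by rewrite -ltnS -[X in (_ < X)%N](size_iota 0 n.+1) -has_find.
split => //; have := nth_find 0 ha; rewrite -/(tail_rank K mu) nth_iota//.
rewrite add0n /a big_geq_mkord; apply: le_trans; rewrite le_eqVlt; apply/orP; left.
by apply/eqP/eq_bigl => i; rewrite -leqNgt.
Qed.

Lemma mxtrace_trunc_approx K l : K^T = K ->
  \tr (trunc_approx K l) = \sum_(i < n | (i < l)%N) (eig K)`_i.
Proof.
move=> KT; have [UU _ _ _] := eigdecP KT.
rewrite /trunc_approx mxtrace_mulC mulmxA UU mul1mx mxtrace_diag.
by rewrite [RHS]big_mkcond; apply: eq_bigr => i _; rewrite mxE.
Qed.

(** The disjunction encodes [r >= min (n, ...)]; a zero tail leaves only the first case. The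
    recursion runs with the exact tail, compared with [mu] only at the end. *)
Lemma rpc_mean_trace_le K (mu : R) (r : nat) :
  psd K -> 0 < mu -> (r <= n)%N ->
  let l := tail_rank K mu in
  let tail := \tr (K - trunc_approx K l) in
  ((n <= r)%N \/
   (0 < tail /\ l%:R * (1 + ln (\tr K / tail)) <= r%:R)) ->
  rpc_E (@mxtrace R n) r K <= 2 * mu.
Proof.
move=> Kp mu0 rn l tail [nr|[tail0 hr]].
  rewrite rpc_E_exhaust ?mulr_ge0 ?ltW// (leq_trans _ nr)//.
  by rewrite -[leqRHS]card_ord max_card.
have [KT _] := Kp; have dec := eigdecP KT; have [UU _ _ _] := dec.
pose U := (eigdec K).1; pose P := [pred i : 'I_n | (i < l)%N].
have trK := mxtrace_energy P UU K.
have eE : energy U P K = \tr (trunc_approx K l).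
  rewrite mxtrace_trunc_approx//; apply: eq_bigr => i _.
  exact: eig_qform.
have cE : coenergy U P K = tail.
  by rewrite /tail raddfB /= -eE trK addrC addKr.
have tail_mu : tail <= mu.
  rewrite -cE; apply: le_trans (tail_rankP K (ltW mu0)).2.
  by apply: ler_sum => i _; rewrite (eig_qform _ dec).
(* The recursion requires [c >= 1]; if [l = 0], the leading energy is zero. *)
pose c : R := (maxn l 1)%:R.
have c1 : 1 <= c by rewrite /c ler1n leq_maxr.
have Pc : \sum_(i < n | P i) 1 <= c.
  rewrite -(big_ord_widen n (fun=> 1)); last exact: (tail_rankP K (ltW mu0)).1.
  by rewrite sumr_const card_ord /c ler_nat leq_maxl.
have := mean_trace_le UU c1 tail0 Pc rn Kp; rewrite cE => /(_ (lexx _)).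
move/le_trans; apply; apply: (@le_trans _ _ (tail + tail)); last lra.
rewrite lerD2l; apply: iter_energy_map_le => //; first exact: energy_ge0.
move=> e0; rewrite -cE -trK cE.
have l0 : (0 < l)%N.
  rewrite lt0n; apply: contraTneq e0 => l0.
  by rewrite /energy big_pred0 ?ltxx// => i /=; rewrite l0.
by rewrite /c (maxn_idPl l0).
Qed.

End Assembly.

Theorem theorem3 (R : realType) (n : nat) (K : 'M[R]_n) (mu delta eps lam sigk : R)
  (r : nat) (L : 'M[R]_n) :
  psd K -> 0 < mu -> 0 < delta < 1 -> 0 < eps < 1 -> 0 < lam -> 0 < sigk ->
  (r <= n)%N ->
  let l := tail_rank K mu in
  let tail := \tr (K - trunc_approx K l) in
  ((n <= r)%N \/
   (0 < tail /\ l%:R * (1 + ln (\tr K / tail)) <= r%:R)) ->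
  L^T = L -> loewner_ge L (mu%:M) ->
  rpc_Pr K (fun s : r.-tuple 'I_n =>
    let F := rpc_F K s in
    let P := F *m F^T + (lam * sigk) *: (ones R n *m (ones R n)^T) + L in
    let A := K + (lam * sigk) *: (ones R n *m (ones R n)^T) + L in
    kappa (minvsqrt P *m A *m minvsqrt P) <= 3 / delta /\
    forall (b : 'cV[R]_n) (t : nat),
      (Num.sqrt delta)^-1 * ln (2 / eps) <= t%:R ->
      Anorm A (pcg_iter A P b t - invmx A *m b) <= eps * Anorm A (invmx A *m b))
  >= 1 - delta.
Proof.
move=> Kp mu0 d01 /andP[e0 e1] lam0 sig0 rn l tail hr LT [_ Lmu].
have /andP[d0 d1] := d01.
have mean := rpc_mean_trace_le Kp mu0 rn hr.
(* At this Markov threshold the mean bound [2 mu] gives failure probability at most [delta]. *)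
have c0 : 0 < 2 * mu / delta by rewrite divr_gt0// mulr_gt0.
apply: (@le_trans _ _ (1 - rpc_E (@mxtrace R n) r K / (2 * mu / delta))).
  by rewrite lerD2l lerN2 ler_pdivrMr// mulrC divfK// gt_eqF.
apply: rpc_Markov => // s; set Res := foldl _ _ _ => Res_le.
set G := (lam * sigk) *: _ => F P A.
have Rp : psd Res := psd_foldl_rp_step s Kp.
have APR : A = P + Res.
  by rewrite /P /A /Res rpc_residual [RHS]addrC !addrA subrK.
have Gp : psd G by apply: psdZ; [rewrite mulr_ge0// ltW | exact: psd_outer].
have FG : psd (F *m F^T + G) by apply: psdD => //; exact: psd_outer.
have [FGT FGge] := FG.
have PT : P^T = P by rewrite linearD /= FGT LT.
have AT : A^T = A by rewrite APR linearD /= PT; have [-> _] := Rp.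
have Lge x : mu * dot x x <= qform L x.
  by have := Lmu x; rewrite qformB qform_scalar subr_ge0.
have Pge x : mu * dot x x <= qform P x.
  by rewrite qformD (le_trans (Lge x))// lerDr.
have Ppos x : x != 0 -> 0 < qform P x.
  by move=> x0; apply: lt_le_trans (Pge x); rewrite mulr_gt0 ?dot_gt0.
clearbody P A.
have PA x : qform P x <= qform A x.
  by rewrite APR qformD lerDl; have [_] := Rp; exact.
have AP x : qform A x <= 3 / delta * qform P x.
  have h1 : qform Res x <= 2 / delta * qform P x.
    rewrite (le_trans (qform_le_trace x Rp))//.
    apply: (@le_trans _ _ (2 * mu / delta * dot x x)).
      by rewrite ler_wpM2r ?dot_ge0.
    by rewrite (mulrAC 2 mu) -(mulrA (2 / delta)) ler_wpM2l// ltW// divr_gt0.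
  have P0 : 0 <= qform P x.
    by apply: le_trans (Pge x); rewrite mulr_ge0 ?dot_ge0// ltW.
  have h2 : qform P x <= delta^-1 * qform P x.
    by rewrite ler_peMl// invf_ge1// ltW.
  have -> : 3 / delta = delta^-1 + 2 / delta by field; rewrite gt_eqF.
  by rewrite mulrDl APR qformD lerD.
have k1 : 1 < 3 / delta by rewrite ltr_pdivlMr// mul1r (lt_trans d1)// ltr1n.
split; first by apply: (precond_kappa AT PT Ppos PA AP); rewrite ltW// (lt_trans ltr01).
move=> b t ht; rewrite /Anorm.
have err := precond_pcg AT PT Ppos PA AP b t k1.
have rate := cheb_rate d01 e0 ht.
set q1 := qform A (pcg_iter _ _ _ _ - _) in err *.
set q0 := qform A (invmx A *m b) in err *.
have q10 : 0 <= q1.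
  by apply: le_trans (PA _); apply: le_trans (Pge _); rewrite mulr_ge0 ?dot_ge0// ltW.
have -> : eps * Num.sqrt q0 = Num.sqrt (eps ^+ 2 * q0).
  by rewrite sqrtrM ?sqr_ge0// sqrtr_sqr ger0_norm// ltW.
rewrite ler_wsqrtr//.
(* The chain is [eps^-2 q1 <= cheb ^ 2 q1 <= q0]. *)
rewrite mulrC -ler_pdivrMr ?exprn_gt0// mulrC -exprVn (le_trans _ err)//.
rewrite ler_wpM2r// lerXn2r// ?nnegrE ?invr_ge0 ?(ltW e0)//.
by rewrite (le_trans _ rate)// invr_ge0 ltW.
Qed.
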